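(* Let $n,p,m\ge 1$, $A\in\mathbb{R}^{n\times n}$, $B\in\mathbb{R}^{n\times p}$, $C\in\mathbb{R}^{m\times n}$, and for $T>0$ set $$R_T=\int_0^T e^{tA^\top}C^\top C e^{tA}\,dt .$$ The following conditions are equivalent: (i) the system $x'=Ax+Bu$ with observation $y=Cx$ is observable; (ii) the system $x'=Ax+Bu$ with observation $y=Cx$ is observable at a given time $T>0$; (iii) $R_T$ is invertible for some $T>0$; (iv) $R_T$ is invertible for all $T>0$; (v) $\operatorname{rank}\begin{bmatrix} C\\ CA\\ \vdots\\ CA^{n-1}\end{bmatrix}=n$.
   Context: The system $x'=Ax+Bu$, $y=Cx$ is called observable if for all $x_0\neq z_0$ in $\mathbb{R}^n$ there exist $\tau>0$ and $u\in L^1((0,\tau);\mathbb{R}^p)$ such that $Cx(\tau)\neq Cz(\tau)$, where $x'=Ax+Bu$ in $(0,\tau)$, $x(0)=x_0$, and $z'=Az+Bu$ in $(0,\tau)$, $z(0)=z_0$ (same control $u$). For a given $T>0$, it is called observable at time $T$ if for all $x_0\ne z_0$ in $\mathbb{R}^n$ there exist $\tau\in(0,T]$ and $u\in L^1((0,\tau);\mathbb{R}^p)$ such that $Cx(\tau)\neq Cz(\tau)$, where $x'=Ax+Bu$ in $(0,\tau)$, $x(0)=x_0$, and $z'=Az+Bu$ in $(0,\tau)$, $z(0)=z_0$ (same control $u$). In (ii), $T>0$ is an arbitrary fixed time. *)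

(* Defs.v *)
From HB Require Import structures.
From mathcomp Require Import all_boot all_order all_algebra.
From mathcomp Require Import all_classical all_reals all_analysis.

Set Implicit Arguments.
Unset Strict Implicit.
Unset Printing Implicit Defensive.

Import Order.TTheory GRing.Theory Num.Theory.
Import numFieldNormedType.Exports.

Local Open Scope classical_set_scope.
Local Open Scope ring_scope.

Section LinearControl.
Variable R : realType.

(* The limit is taken in the matrix space normed by the maximum of the
   absolute values of the entries. *)
Definition expmx (n : nat) (A : 'M[R]_n) : 'M[R]_n :=
  limn (series (fun k => (k`!%:R)^-1 *: A ^+ k)).

(* A pair J in s stands for the interval with endpoints J.1 <= J.2; the
   intervals of s may touch at their endpoints. *)
Definition abs_continuous (n : nat) (a b : R) (f : R -> 'cV[R]_n) : Prop :=
  forall e : R, 0 < e -> exists2 d : R, 0 < d &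
    forall s : seq (R * R),
      all (fun J => (a <= J.1) && (J.1 <= J.2) && (J.2 <= b)) s ->
      pairwise (fun J K => (J.2 <= K.1) || (K.2 <= J.1)) s ->
      \sum_(J <- s) (J.2 - J.1) < d ->
      \sum_(J <- s) `|f J.2 - f J.1| < e.

Definition L1_control (p : nat) (tau : R) (u : R -> 'cV[R]_p) : Prop :=
  forall i : 'I_p,
    lebesgue_measure.-integrable `]0, tau[ (EFin \o (fun t => u t i 0)).

(* Since u is only L^1, x' = A x + B u is understood in the sense of
   Caratheodory. Values of x and u outside [0, tau] are irrelevant. *)
Definition trajectory (n p : nat) (A : 'M[R]_n) (B : 'M[R]_(n, p)) (tau : R)
    (u : R -> 'cV[R]_p) (x0 : 'cV[R]_n) (x : R -> 'cV[R]_n) : Prop :=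
  [/\ abs_continuous 0 tau x,
      {ae lebesgue_measure, forall t : R, t \in `]0, tau[ ->
         is_derive t 1 x (A *m x t + B *m u t)} &
      x 0 = x0].

Definition distinguished_at (n p m : nat) (A : 'M[R]_n) (B : 'M[R]_(n, p))
    (C : 'M[R]_(m, n)) (x0 z0 : 'cV[R]_n) (tau : R) : Prop :=
  exists (u : R -> 'cV[R]_p) (x z : R -> 'cV[R]_n),
    [/\ L1_control tau u, trajectory A B tau u x0 x,
        trajectory A B tau u z0 z & C *m x tau <> C *m z tau].

Definition observable (n p m : nat) (A : 'M[R]_n) (B : 'M[R]_(n, p))
    (C : 'M[R]_(m, n)) : Prop :=
  forall x0 z0 : 'cV[R]_n, x0 <> z0 ->
    exists2 tau : R, 0 < tau & distinguished_at A B C x0 z0 tau.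

Definition observable_at_time (n p m : nat) (A : 'M[R]_n) (B : 'M[R]_(n, p))
    (C : 'M[R]_(m, n)) (T : R) : Prop :=
  forall x0 z0 : 'cV[R]_n, x0 <> z0 ->
    exists2 tau : R, 0 < tau <= T & distinguished_at A B C x0 z0 tau.

Definition obs_gramian (n m : nat) (A : 'M[R]_n) (C : 'M[R]_(m, n)) (T : R) :
    'M[R]_n :=
  \matrix_(i, j) \int[lebesgue_measure]_(t in `[0, T])
    (expmx (t *: A^T) *m C^T *m C *m expmx (t *: A)) i j.

Definition kalman_obs_mx (n m : nat) (A : 'M[R]_n) (C : 'M[R]_(m, n)) :
    'M[R]_(\sum_(k < n) m, n) :=
  \mxcol_(k < n) (C *m A ^+ k).

End LinearControl.

(* Main.v *)
(* Distinct states x0, z0 under a common control differ by a solution w of the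
   homogeneous equation w' = A w, so they are distinguished at time tau exactly
   when C e^{tau A} (x0 - z0) <> 0, whatever the control.  Every condition thus
   says that the space of v with C A^k v = 0 for all k is trivial: by the
   exponential series such v satisfy C e^{tA} v = 0 for all t; conversely,
   differentiating C e^{tA} v = 0 repeatedly on ]0, T[ and letting t -> 0 gives
   C A^k v = 0.  Finally v^T R_T v is the integral of |C e^{tA} v|^2, and
   Cayley-Hamilton reduces all k to k < n. *)
Require Import Defs.
From mathcomp Require Import all_boot all_order all_algebra.
From mathcomp Require Import all_classical all_reals all_analysis.
From mathcomp Require Import measurable_realfun ring lra.

Set Implicit Arguments.
Unset Strict Implicit.
Unset Printing Implicit Defensive.

Import Order.TTheory GRing.Theory Num.Theory.
Import numFieldNormedType.Exports.
Local Open Scope classical_set_scope.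
Local Open Scope ring_scope.

(** * Absolutely continuous functions with derivative zero almost everywhere *)

(** Let [c] be the supremum of the points of the interval where [P] holds. The step at [c] starts
    from such a point just below [c] and either reaches [b] or passes beyond [c], a contradiction.
    Since steps straddle [t], [P] at [t] itself is never consulted. *)
Lemma local_interval_induction (R : realType) (P : R -> Prop) (a b : R) :
  a <= b -> P a ->
  (forall t, a <= t <= b -> exists2 r, 0 < r & forall x y,
     a <= x -> x <= t -> t <= y -> y <= b -> t - r < x -> y < t + r ->
     P x -> P y) ->
  P b.
Proof.
move=> ab Pa step.
pose S := [set t | a <= t <= b /\ P t].
have Sa : S a by split; rewrite // lexx.
have Sub : ubound S b by move=> x [/andP[_ ->]].
have hS : has_sup S by split; [exists a | exists b].
set c := sup S.
have ac : a <= c by apply: ub_le_sup => //; exists b.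
have cb : c <= b by apply: ge_sup => //; exists a.
have [r r0 Pr] := step c (introT andP (conj ac cb)).
have [x [/andP[ax xb] Px] cx] := sup_adherent r0 hS.
have xc : x <= c by apply: ub_le_sup => //; [exists b | split => //; apply/andP].
have [bcr|bcr] := ltP b (c + r); first exact: (Pr x b).
have Py : S (c + r / 2).
  split; first by apply/andP; split; lra.
  by apply: (Pr x) => //; lra.
have : c + r / 2 <= c by apply: ub_le_sup => //; exists b.
lra.
Qed.

(** The two one-sided increments, from [x] to [t] and from [t] to [y], are each bounded by the
    difference quotient at [t], and their lengths add up. The straddling form fits the step of
    [local_interval_induction]. *)
Lemma is_derive0_slope (R : realType) (V : normedModType R) (f : R -> V) (t e : R) :
  is_derive t 1 f 0 -> 0 < e ->
  exists2 r, 0 < r & forall x y, x <= t -> t <= y -> t - r < x -> y < t + r ->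
     `|f y - f x| <= e * (y - x).
Proof.
move=> [df f0] e0.
have /cvgrPdist_le/(_ e e0) : h^-1 *: (f (h + t) - f t) @[h --> 0^'] --> (0:V).
  rewrite -f0 /derive; move: df; rewrite /derivable.
  rewrite (_ : (fun h : R => h^-1 *: (f (h *: (1:R) + t) - f t)) =
               (fun h : R => h^-1 *: (f (h + t) - f t)))//.
  by apply/funext => h; rewrite /GRing.scale /= mulr1.
move=> [r /= r0 H]; exists r => //.
have slope u : `|u - t| < r -> `|f u - f t| <= e * `|u - t|.
  move=> ur; have [->|ut] := eqVneq u t; first by rewrite !subrr !normr0 mulr0.
  have ut0 : 0 < `|u - t| by rewrite normr_gt0 subr_eq0.
  have := H (u - t); rewrite /ball_ /= sub0r normrN => /(_ ur).
  rewrite subr_eq0 => /(_ ut).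
  by rewrite subrK sub0r normrN normrZ normfV ler_pdivrMl// mulrC.
move=> x y xt ty xr yr.
have hy := slope y; have hx := slope x.
rewrite ger0_norm ?subr_ge0// in hy; rewrite (distrC x) (distrC (f x)) ger0_norm ?subr_ge0// in hx.
have {}hy : `|f y - f t| <= e * (y - t) by apply: hy; lra.
have {}hx : `|f t - f x| <= e * (t - x) by apply: hx; lra.
rewrite -(subrKA (f t)) (le_trans (ler_normD _ _))//.
by apply: (le_trans (lerD hy hx)); rewrite -mulrDr; lra.
Qed.

(* Cover the null set of bad points by an open set U of small measure.  While
   moving from a to b, the increment across a small interval around t is at most
   e times its length if t is good; otherwise the interval lies in U and is
   recorded in s, whose total length stays below the measure of U, so absolute
   continuity bounds the sum of the recorded increments. *)
Lemma abs_continuous_derive0 (R : realType) (n : nat) (a b : R) (f : R -> 'cV[R]_n) :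
  a <= b -> abs_continuous a b f ->
  {ae lebesgue_measure, forall t : R, t \in `]a, b[ -> is_derive t 1 f 0} ->
  f b = f a.
Proof.
move=> ab acf aef; apply/eqP; rewrite -subr_eq0 -normr_le0.
apply/ler_addgt0Pr => e0 e0_gt0; rewrite add0r.
(* Chosen so that [e * (b - a) + e = e0]: the first term pays for the good points, the second for
   the recorded intervals. *)
pose e := e0 / (b - a + 1).
have ba1 : 0 < b - a + 1 by lra.
have e_gt0 : 0 < e by rewrite divr_gt0.
have [d d_gt0 acd] := acf e e_gt0.
have [N [mN N0 subN]] := aef.
(* The derivative is only known inside the open interval, so the endpoints count as bad points. *)
pose M := N `|` ([set a] `|` [set b]).
have mM : measurable M by apply: measurableU => //; exact: measurableU.
have M0 : lebesgue_measure M = 0%E :> \bar R.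
  apply: measure_negligible => //; apply: negligibleU; first by exists N; split => //; exact: N0.
  by apply: negligibleU; apply/negligibleP => //; exact: lebesgue_measure_set1.
have [U [oU MU UM]] := @lebesgue_regularity_outer R M d mM
  (eq_ind_r (fun x => x < +oo)%E (ltry 0) M0) d_gt0.
have mU : measurable U by exact: open_measurable.
have Ud : (lebesgue_measure U < d%:E)%E.
  rewrite (_ : U = (U `\` M) `|` M); last by rewrite setUC setDUK.
  rewrite measureU0//; exact: measurableD.
(* The length is compared with [U] cut at [t], so that an interval added further right is accounted
   for by additivity of the measure. *)
pose P t := exists s : seq (R * R), [/\
    all (fun J => (a <= J.1) && (J.1 <= J.2) && (J.2 <= t)) s,
    pairwise (fun J K => (J.2 <= K.1) || (K.2 <= J.1)) s,
    ((\sum_(J <- s) (J.2 - J.1))%:E <= lebesgue_measure (U `&` `[a, t]))%E &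
    `|f t - f a| <= e * (t - a) + \sum_(J <- s) `|f J.2 - f J.1|].
suff [s [s1 s2 s3 s4]] : P b.
  apply: (le_trans s4).
  have : \sum_(J <- s) `|f J.2 - f J.1| < e.
    apply: acd => //; rewrite -lte_fin (le_lt_trans s3)// (le_lt_trans _ Ud)//.
    by apply: le_measure; rewrite ?inE//; apply: measurableI.
  have -> : e0 = e * (b - a) + e.
    by rewrite -[X in _ + X]mulr1 -mulrDr /e divfK// gt_eqF.
  by move=> /ltW; rewrite lerD2l.
apply: (local_interval_induction ab).
  exists [::]; split => //; first by rewrite big_nil.
  by rewrite big_nil !subrr mulr0 normr0 addr0.
move=> t /andP[a_t tb].
have [Ut|nUt] := pselect (U t).
  have [r /= r0 rU] : exists2 r, 0 < r & ball t r `<=` U.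
    by have /nbhs_ballP[r r0 rU] := open_nbhs_nbhs (conj oU Ut); exists r.
  exists r => // x y ax xt ty yb xr yr [s [s1 s2 s3 s4]].
  exists ((x, y) :: s); split.
  - rewrite /= ax (le_trans xt ty) lexx /=.
    apply/allP => J /(allP s1) /andP[-> J2] /=.
    by rewrite (le_trans J2)// (le_trans xt).
  - rewrite /= s2 andbT; apply/allP => J /(allP s1) /andP[_ J2].
    by rewrite /= J2 orbT.
  - have Lxy : ((y - x)%:E <= lebesgue_measure (`]x, y]%classic : set R))%E.
      rewrite lebesgue_measure_itv /= lte_fin.
      by case: ltP => //; rewrite lee_fin subr_le0.
    rewrite big_cons /= addrC EFinD.
    apply: (@le_trans _ _ (lebesgue_measure ((U `&` `[a, x]) `|` `]x, y]))).
      rewrite measureU//; first last.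
      + rewrite -subset0 => z /= [[_]]; rewrite !in_itv /= => /andP[_ zx] /andP[xz _].
        by have := lt_le_trans xz zx; rewrite ltxx.
      + exact: measurableI.
      by apply: leeD => //; exact: Lxy.
    apply: le_measure; rewrite ?inE//.
    + by apply: measurableU => //; apply: measurableI.
    + by apply: measurableI.
    move=> z [[Uz]|] /=; rewrite in_itv/= => /andP[z1 z2].
      by split => //; rewrite in_itv /= z1 (le_trans z2)// (le_trans xt).
    split; last by rewrite in_itv /= z2 (le_trans ax)// ltW.
    by apply: rU; rewrite /ball /= ltr_norml; apply/andP; split; lra.
  - rewrite big_cons /= -(subrKA (f x)) (le_trans (ler_normD _ _))//.
    rewrite addrCA lerD2l (le_trans s4)// lerD2r ler_pM2l//; lra.
have dft : is_derive t 1 f 0.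
  apply: contrapT => ndf; apply: nUt; apply: MU.
  have [->|ta] := eqVneq t a; first by right; left.
  have [->|tb'] := eqVneq t b; first by right; right.
  left; apply: subN => /= dft; apply: ndf; apply: dft.
  by rewrite in_itv /= !lt_neqAle eq_sym ta a_t tb' tb.
have [r r0 H] := is_derive0_slope dft e_gt0.
exists r => // x y ax xt ty yb xr yr [s [s1 s2 s3 s4]].
have xy := le_trans xt ty.
exists s; split => //.
- apply/allP => J /(allP s1) /andP[-> J2] /=; exact: le_trans xy.
- apply: (le_trans s3); apply: le_measure; rewrite ?inE//; try exact: measurableI.
  by apply: setIS => z /=; rewrite !in_itv/= => /andP[-> zx] /=; exact: le_trans xy.
- have Hxy := H x y xt ty xr yr.
  rewrite -(subrKA (f x)) (le_trans (ler_normD _ _))//.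
  by apply: (le_trans (lerD Hxy s4)); rewrite addrA -mulrDr; lra.
Qed.

(** * The maximum norm on matrices *)

Lemma ler_norm_mx_entry (R : realType) m n (M : 'M[R]_(m, n)) i j :
  `|M i j| <= `|M|.
Proof.
rewrite [leRHS]/Num.Def.normr/= mx_normrE.
exact: (le_bigmax _ (fun ij : 'I_m * 'I_n => `|M ij.1 ij.2|) (i, j)).
Qed.

Lemma mx_norm_ler (R : realType) m n (M : 'M[R]_(m, n)) (c : R) :
  0 <= c -> (forall i j, `|M i j| <= c) -> `|M| <= c.
Proof.
move=> c0 H; rewrite [leLHS]/Num.Def.normr/= mx_normrE.
by apply: bigmax_le => // -[i j] _; exact: H.
Qed.

(** Each entry of the product is a sum of [n] terms, whence the factor [n]: the maximum norm is not
    submultiplicative. *)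
Lemma norm_mulmx (R : realType) m n q (M : 'M[R]_(m, n)) (N : 'M[R]_(n, q)) :
  `|M *m N| <= n%:R * `|M| * `|N|.
Proof.
apply: mx_norm_ler => [|i j]; first by rewrite !mulr_ge0.
rewrite mxE (le_trans (ler_norm_sum _ _ _))//.
apply: (@le_trans _ _ (\sum_(k < n) `|M| * `|N|)).
  by apply: ler_sum => k _; rewrite normrM ler_pM// ler_norm_mx_entry.
by rewrite sumr_const card_ord -(mulr_natl (_ * _)) mulrA.
Qed.

(** There are finitely many entries, so one rank serves all of them. *)
Lemma cvg_mx (R : realType) m n (u : nat -> 'M[R]_(m, n)) (L : 'M[R]_(m, n)) :
  (forall i j, (fun k => u k i j) @ \oo --> L i j) -> u @ \oo --> L.
Proof.
move=> H; apply/cvgrPdist_le => e e0.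
near=> k; apply: mx_norm_ler; first exact: ltW.
suff: forall i j, `|L i j - u k i j| <= e by move=> + i j => /(_ i j); rewrite !mxE.
near: k; apply: filter_forall => i; apply: filter_forall => j.
exact: ((cvgrPdist_le _ _).1 (H i j)).
Unshelve. all: by end_near. Qed.

Lemma cvg_mulmx2 (R : realType) m n q (u : nat -> 'M[R]_n) (L : 'M[R]_n)
    (C : 'M[R]_(m, n)) (P : 'M[R]_(n, q)) i j :
  u @ \oo --> L ->
  (fun k => (C *m u k *m P) i j) @ \oo --> (C *m L *m P) i j.
Proof.
move=> uL; apply/cvgrPdist_le => e e0.
(* The constant of two uses of [norm_mulmx], increased by 1 to make it positive. *)
pose K := n%:R * (n%:R * `|C|) * `|P| + 1.
have K0 : 0 < K by rewrite ltr_wpDl// !mulr_ge0.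
have /cvgrPdist_le/(_ (e / K)) := uL; rewrite divr_gt0// => /(_ isT).
apply: filterS => k ek.
have -> : (C *m L *m P) i j - (C *m u k *m P) i j = (C *m (L - u k) *m P) i j.
  by rewrite mulmxBr mulmxBl !mxE.
apply: (le_trans (ler_norm_mx_entry _ _ _)); apply: (le_trans (norm_mulmx _ _)).
apply: (@le_trans _ _ (n%:R * (n%:R * `|C| * `|L - u k|) * `|P|)).
  by rewrite ler_wpM2r// ler_wpM2l// norm_mulmx.
rewrite -[leRHS](divfK (lt0r_neq0 K0)) (_ : _ * _ * _ = (K - 1) * `|L - u k|); last first.
  by rewrite /K; ring.
rewrite (mulrC (e / K)) ler_pM//; last by lra.
by rewrite /K addrK !mulr_ge0.
Qed.

(** * The matrix exponential as a power series *)

Section exponential_entries.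
Context {R : realType} {m n q : nat}.
Implicit Types (A : 'M[R]_n) (C : 'M[R]_(m, n)) (P : 'M[R]_(n, q)).

(* Coefficients in t of the entries of C e^{tA} P. *)
Definition exp_entry A C P i j : R^nat :=
  fun k => (k`!%:R)^-1 * (C *m A ^+ k *m P) i j.

(** The factor [k.+1] turns [k.+1]! into [k]! and the extra factor [A] is absorbed by [P]. Keeping
    [P] general makes the family closed under differentiation. *)
Lemma pseries_diffs_exp_entry A C P i j :
  pseries_diffs (exp_entry A C P i j) = exp_entry A C (A *m P) i j.
Proof.
apply/funext => k; rewrite /pseries_diffs /exp_entry factS natrM invfM mulrA.
by rewrite mulVKf// exprSr -!mulmxA.
Qed.

(** Absolute convergence by comparison with [M] times the series of the scalar exponential at
    [K * |x|]. *)
Lemma is_cvg_exp_entry A C P i j x : cvgn (pseries (exp_entry A C P i j) x).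
Proof.
pose K := n%:R * `|A|; pose M := n%:R * `|C| * `|P|.
have K0 : 0 <= K by rewrite mulr_ge0.
have M0 : 0 <= M by rewrite !mulr_ge0.
have bnd k : `|(C *m A ^+ k *m P) i j| <= M * K ^+ k.
  rewrite (le_trans (ler_norm_mx_entry _ _ _))// /M {M M0}.
  (* [P] is generalized: one factor [A] is moved into it at the cost of a factor [K]. *)
  elim: k P => [|k IH] P; first by rewrite expr0 mulmx1 mulr1 norm_mulmx.
  rewrite exprSr (_ : C *m (A ^+ k * A) *m P = C *m A ^+ k *m (A *m P)); last first.
    by rewrite !mulmxA.
  rewrite (le_trans (IH _))// exprS mulrA ler_wpM2r ?exprn_ge0//.
  rewrite (_ : _ * K = n%:R * `|C| * (n%:R * `|A| * `|P|)); last by rewrite /K; ring.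
  by rewrite ler_wpM2l ?mulr_ge0// norm_mulmx.
apply: normed_cvg.
apply: (@series_le_cvg _ _ (M *: exp_coeff (K * `|x|))); last first.
- exact: is_cvg_seriesZ (is_cvg_series_exp_coeff (K * `|x|)).
- move=> k /=; rewrite /exp_entry !normrM normfV normr_nat normrX.
  rewrite (_ : (M *: exp_coeff (K * `|x|)) k =
               (k`!%:R)^-1 * (M * K ^+ k) * `|x| ^+ k); last first.
    rewrite -[LHS]/(M * ((K * `|x|) ^+ k / k`!%:R)) exprMn; ring.
  by rewrite ler_wpM2r// ?exprn_ge0// ler_wpM2l// invr_ge0.
- move=> k; rewrite -[leRHS]/(M * ((K * `|x|) ^+ k / k`!%:R)).
  by rewrite mulr_ge0// divr_ge0// exprn_ge0// mulr_ge0.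
- by move=> k /=.
Qed.

End exponential_entries.

Lemma scale_exprmx (R : realType) n (A : 'M[R]_n) (t : R) k :
  (t *: A) ^+ k = t ^+ k *: A ^+ k.
Proof.
elim: k => [|k IH]; first by rewrite !expr0 scale1r.
by rewrite !exprS IH -[LHS]/((t *: A) *m (t ^+ k *: A ^+ k)) -scalemxAl -scalemxAr scalerA.
Qed.

(** [expmx] is a [limn], which is meaningful only once the series is known to converge; this follows
    from the entries with [C] and [P] the identity, at the point 1. *)
Lemma cvg_expmx (R : realType) n (A : 'M[R]_n) :
  series (fun k => (k`!%:R)^-1 *: A ^+ k) @ \oo --> expmx A.
Proof.
suff : cvgn (series (fun k => (k`!%:R)^-1 *: A ^+ k)) by [].
apply/cvg_ex.
exists (\matrix_(i, j) limn (pseries (exp_entry A 1%:M 1%:M i j) 1)).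
apply: cvg_mx => i j; rewrite mxE.
rewrite (_ : (fun _ => _) = pseries (exp_entry A 1%:M 1%:M i j) 1).
  exact: is_cvg_exp_entry.
apply/funext => k; rewrite /pseries /series /= summxE; apply: eq_bigr => l _.
by rewrite mxE /exp_entry mulmx1 mul1mx expr1n mulr1.
Qed.

(** Reduces analysis of the matrix exponential to scalar power series: multiplication by fixed
    matrices commutes with the limit of the partial sums. *)
Lemma expmxE (R : realType) m n q (A : 'M[R]_n) (C : 'M[R]_(m, n))
    (P : 'M[R]_(n, q)) (t : R) i j :
  (C *m expmx (t *: A) *m P) i j = limn (pseries (exp_entry A C P i j) t).
Proof.
apply/esym/cvg_lim => //.
rewrite (_ : pseries _ t =
  (fun k => (C *m series (fun k => (k`!%:R)^-1 *: (t *: A) ^+ k) k *m P) i j)).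
  by apply: cvg_mulmx2; exact: cvg_expmx.
apply/funext => k; rewrite /pseries /series /= mulmx_sumr mulmx_suml summxE.
apply: eq_bigr => l _; rewrite scale_exprmx scalerA -scalemxAr -scalemxAl mxE /exp_entry.
ring.
Qed.

Lemma is_derive_mx (R : realType) m n (f : R -> 'M[R]_(m, n)) (t : R) (df : 'M[R]_(m, n)) :
  is_derive t 1 f df <-> forall i j, is_derive t 1 (fun s => f s i j) (df i j).
Proof.
split=> [[fd fE] i j|H].
  by split; [exact: (derivable_mxP _ _ _).1 | rewrite -fE derive_mx// mxE].
have fd : derivable f t 1 by apply/derivable_mxP => i j; have [] := H i j.
split=> //; rewrite derive_mx//; apply/matrixP => i j; rewrite mxE.
by have [] := H i j.
Qed.

Lemma is_derive_expmx (R : realType) m n q (A : 'M[R]_n) (C : 'M[R]_(m, n))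
    (P : 'M[R]_(n, q)) (t : R) :
  is_derive t 1 (fun s => C *m expmx (s *: A) *m P)
    (C *m expmx (t *: A) *m (A *m P)).
Proof.
apply/is_derive_mx => i j.
rewrite expmxE -pseries_diffs_exp_entry.
rewrite (_ : (fun s : R => _) = (fun s => limn (pseries (exp_entry A C P i j) s))); last first.
  by apply/funext => s; exact: expmxE.
(* Termwise differentiation at [t] requires convergence at some point of larger modulus. *)
apply: (@pseries_snd_diffs _ _ (`|t| + 1)); rewrite ?pseries_diffs_exp_entry;
  try exact: is_cvg_exp_entry.
by rewrite [ltRHS]ger0_norm ?addr_ge0// ltrDl.
Qed.

Lemma continuous_expmx (R : realType) m n q (A : 'M[R]_n) (C : 'M[R]_(m, n))
    (P : 'M[R]_(n, q)) :
  continuous (fun s : R => C *m expmx (s *: A) *m P).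
Proof.
move=> t; apply/differentiable_continuous/derivable1_diffP.
by have [] := is_derive_expmx A C P t.
Qed.

Lemma expmx0 (R : realType) n : expmx (0 : 'M[R]_n) = 1%:M.
Proof.
apply: cvg_lim; first exact: norm_hausdorff.
apply: cvg_near_cst; near=> k.
(* The partial sum of index 0 is empty; from index 1 on it contains the identity term. *)
have [l ->] : exists l, k = l.+1 by exists k.-1; rewrite prednK//; near: k; exists 1%N.
rewrite /series /= big_nat_recl// big1 ?addr0 ?expr0 ?invr1 ?scale1r// => i _.
by rewrite exprS -[0 * _]/(0 *m _) mul0mx scaler0.
Unshelve. all: by end_near. Qed.

Lemma trmx_expr (R : realType) n (A : 'M[R]_n) k : (A ^+ k)^T = A^T ^+ k.
Proof.
elim: k => [|k IH]; first by rewrite !expr0 trmx1.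
by rewrite exprS exprSr -[LHS]/((A *m A ^+ k)^T) trmx_mul IH.
Qed.

Lemma expmx_tr (R : realType) n (A : 'M[R]_n) : expmx A^T = (expmx A)^T.
Proof.
apply: cvg_lim; first exact: norm_hausdorff.
apply: cvg_mx => i j; rewrite mxE.
have := @cvg_mulmx2 R n n n _ _ 1%:M 1%:M j i (@cvg_expmx R n A).
rewrite mulmx1 mul1mx; apply: cvg_trans; apply: near_eq_cvg.
apply: nearW => k; rewrite mulmx1 mul1mx /series /= !summxE.
by apply: eq_bigr => l _; rewrite !mxE -trmx_expr mxE.
Qed.

(** Both sides have the same power series coefficients, because [A] commutes with its powers. *)
Lemma expmx_comm (R : realType) n (A : 'M[R]_n) (t : R) :
  A *m expmx (t *: A) = expmx (t *: A) *m A.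
Proof.
apply/matrixP => i j.
rewrite -[A *m _]mulmx1 -[X in X *m A]mul1mx !expmxE.
congr (limn (pseries _ t)); apply/funext => k; rewrite /exp_entry mul1mx mulmx1.
by rewrite -[A *m _]/(A * A ^+ k) -[A ^+ k *m _]/(A ^+ k * A) -exprS -exprSr.
Qed.

(** * Differentiation rules and stability of absolute continuity *)

Lemma is_derive_mulmx (R : realType) m n q (M : R -> 'M[R]_(m, n)) (f : R -> 'M[R]_(n, q))
    (t : R) dM df :
  is_derive t 1 M dM -> is_derive t 1 f df ->
  is_derive t 1 (fun s => M s *m f s) (dM *m f t + M t *m df).
Proof.
move=> /is_derive_mx HM /is_derive_mx Hf; apply/is_derive_mx => i j.
rewrite (_ : (fun s => _) = \sum_(k < n) (fun s => M s i k * f s k j)); last first.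
  by apply/funext => s; rewrite mxE fct_sumE.
rewrite (_ : _ i j = \sum_(k < n) (M t i k *: df k j + f t k j *: dM i k)); last first.
  rewrite !mxE -big_split; apply: eq_bigr => k _ /=.
  by rewrite addrC /GRing.scale /= (mulrC (f t k j)).
have H k := is_deriveM (HM i k) (Hf k j).
exact: is_derive_sum.
Qed.

Lemma is_derive_reflect (R : realType) m n (f : R -> 'M[R]_(m, n)) (s t : R) df :
  is_derive (s - t) 1 f df -> is_derive t 1 (fun r => f (s - r)) (- df).
Proof.
move=> /is_derive_mx H; apply/is_derive_mx => i j.
rewrite mxE -[- df i j]mulrN1.
apply: (@is_derive1_comp _ (fun s => f s i j) (fun r => s - r)) => //.
rewrite -[-1]add0r.
exact: is_deriveB.
Qed.

Lemma abs_continuous_le (R : realType) n q (a b K : R) (f : R -> 'cV[R]_n) (g : R -> 'cV[R]_q) :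
  0 <= K -> abs_continuous a b f ->
  (forall x y, a <= x -> x <= y -> y <= b -> `|g y - g x| <= K * (`|f y - f x| + (y - x))) ->
  abs_continuous a b g.
Proof.
move=> K0 acf H e e0.
have K1 : 0 < K + 1 by lra.
(* One [e'] bounds the increments of [f], another the total length; the sum is then at most
   [K * e / (K + 1)], below [e]. *)
pose e' := e / (K + 1) / 2.
have e'0 : 0 < e' by rewrite !divr_gt0.
have [d d0 acd] := acf e' e'0.
exists (Num.min d e'); first by rewrite lt_min d0.
move=> s s1 s2; rewrite lt_min => /andP[sd se].
have := acd s s1 s2 sd => sf.
apply: (@le_lt_trans _ _ (\sum_(J <- s) K * (`|f J.2 - f J.1| + (J.2 - J.1)))).
  rewrite big_seq [leRHS]big_seq; apply: ler_sum => J /(allP s1) /andP[/andP[aJ JJ] Jb].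
  exact: H.
rewrite -mulr_sumr big_split /=.
apply: (@le_lt_trans _ _ (K * (e' + e'))).
  by rewrite ler_wpM2l// lerD// ltW.
rewrite (_ : e' + e' = e / (K + 1)); last by rewrite /e' [RHS]splitr.
by rewrite mulrC -mulrA -[ltRHS]mulr1 ltr_pM2l// mulrC ltr_pdivrMr// mul1r ltrDl.
Qed.

Lemma abs_continuous_lipschitz (R : realType) n (a b K : R) (f : R -> 'cV[R]_n) :
  0 <= K ->
  (forall x y, a <= x -> x <= y -> y <= b -> `|f y - f x| <= K * (y - x)) ->
  abs_continuous a b f.
Proof.
move=> K0 H; apply: (@abs_continuous_le _ n n a b K (fun=> 0)) => //.
  move=> e e0; exists 1 => // s _ _ _.
  by rewrite big1// => J _; rewrite subrr normr0.
by move=> x y ax xy yb; rewrite subrr normr0 add0r; exact: H.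
Qed.

Lemma abs_continuousB (R : realType) n (a b : R) (f g : R -> 'cV[R]_n) :
  abs_continuous a b f -> abs_continuous a b g ->
  abs_continuous a b (fun t => f t - g t).
Proof.
move=> acf acg e e0.
have e20 : 0 < e / 2 by rewrite divr_gt0.
have [d d0 acd] := acf _ e20.
have [d' d'0 acd'] := acg _ e20.
exists (Num.min d d'); first by rewrite lt_min d0.
move=> s s1 s2; rewrite lt_min => /andP[sd sd'].
have Hf := acd s s1 s2 sd; have Hg := acd' s s1 s2 sd'.
rewrite (splitr e); apply: le_lt_trans (ltrD Hf Hg).
rewrite -big_split /=; apply: ler_sum => J _.
rewrite (_ : _ - _ = (f J.2 - f J.1) - (g J.2 - g J.1)); first exact: ler_normB.
by rewrite !opprB addrACA [RHS]addrACA (addrC (- g J.2)).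
Qed.

(** Absolute continuity on a single interval shorter than [d] gives an increment below 1, so each
    step of the interval induction raises the bound by 1. *)
Lemma abs_continuous_bounded (R : realType) n (a b : R) (f : R -> 'cV[R]_n) :
  a <= b -> abs_continuous a b f ->
  exists2 M, 0 <= M & forall t, a <= t <= b -> `|f t| <= M.
Proof.
move=> ab /(_ 1 ltr01)[d d0 acd].
have near x y : a <= x -> x <= y -> y <= b -> y - x < d -> `|f y - f x| < 1.
  move=> ax xy yb yxd; have := acd [:: (x, y)].
  rewrite !big_seq1 /= !andbT; apply => //.
  by rewrite ax xy yb.
apply: (local_interval_induction (P := fun s =>
    exists2 M, 0 <= M & forall t, a <= t <= s -> `|f t| <= M) ab).
  exists `|f a| => // t; rewrite -eq_le => /eqP <-//.
move=> t /andP[a_t tb]; exists (d / 2); first by rewrite divr_gt0.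
move=> x y ax xt ty yb xd yd [M M0 HM]; exists (M + 1); first by rewrite addr_ge0.
move=> z /andP[az zy]; have [zx|xz] := leP z x.
  by rewrite ler_wpDr// HM// az.
rewrite -(subrK (f x) (f z)) addrC (le_trans (ler_normD _ _))// lerD//.
  by rewrite HM// ax lexx.
by rewrite ltW// near//; lra.
Qed.

Lemma expmx_bounded (R : realType) m n q (A : 'M[R]_n) (C : 'M[R]_(m, n))
    (P : 'M[R]_(n, q)) (a b : R) :
  a <= b ->
  exists2 K, 0 <= K & forall t, a <= t <= b -> `|C *m expmx (t *: A) *m P| <= K.
Proof.
move=> ab; have [|c _ Hc] := @EVT_max R (fun t => `|C *m expmx (t *: A) *m P|) a b ab.
  apply: continuous_subspaceT => t.
  apply: (@continuous_comp _ _ _ (fun s : R => C *m expmx (s *: A) *m P) (fun M => `|M|)).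
    exact: continuous_expmx.
  exact: norm_continuous.
by exists `|C *m expmx (c *: A) *m P| => // t tab; apply: Hc; rewrite in_itv.
Qed.

(** Mean value theorem entry by entry, the derivative being bounded by [expmx_bounded] applied to
    [A *m P]. *)
Lemma expmx_lipschitz (R : realType) m n q (A : 'M[R]_n) (C : 'M[R]_(m, n))
    (P : 'M[R]_(n, q)) (a b : R) :
  a <= b ->
  exists2 K, 0 <= K & forall x y, a <= x -> x <= y -> y <= b ->
    `|C *m expmx (y *: A) *m P - C *m expmx (x *: A) *m P| <= K * (y - x).
Proof.
move=> ab; have [K K0 HK] := expmx_bounded A C (A *m P) ab.
exists K => // x y ax xy yb; apply: mx_norm_ler => [|i j].
  by rewrite mulr_ge0// subr_ge0.
have D (s : R) : is_derive s 1 (fun s => (C *m expmx (s *: A) *m P) i j)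
    ((C *m expmx (s *: A) *m (A *m P)) i j).
  by have /is_derive_mx/(_ i j) := is_derive_expmx A C P s.
have [|c cxy E] := @MVT_segment R _ _ x y xy (fun s _ => D s).
  apply: continuous_subspaceT => s.
  by apply/differentiable_continuous/derivable1_diffP; have [] := D s.
rewrite [X in `|X|]mxE [X in _ + X]mxE E normrM (@ger0_norm _ (y - x)) ?subr_ge0//.
rewrite ler_wpM2r ?subr_ge0//.
move: E; rewrite in_itv /= in cxy; case/andP: cxy => xc cy _.
apply: le_trans (HK c _); last by rewrite (le_trans ax)// (le_trans cy).
exact: ler_norm_mx_entry.
Qed.

(** * Trajectories and distinguishability *)

(** The function [F t], which is the exponential of [(tau - t) *: A] applied to [w t], is absolutely
    continuous with zero derivative almost everywhere, hence constant; its values at [tau] and 0 are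
    the two sides. *)
Lemma homogeneous_solution (R : realType) n (A : 'M[R]_n) (tau : R) (w : R -> 'cV[R]_n) :
  0 <= tau -> abs_continuous 0 tau w ->
  {ae lebesgue_measure, forall t : R, t \in `]0, tau[ -> is_derive t 1 w (A *m w t)} ->
  w tau = expmx (tau *: A) *m w 0.
Proof.
move=> tau0 acw dw.
pose F t := expmx ((tau - t) *: A) *m w t.
suff : F tau = F 0 by rewrite /F subrr scale0r expmx0 mul1mx subr0.
apply: abs_continuous_derive0 => //.
  have [K1 K10 HK1] := expmx_bounded A 1%:M 1%:M tau0.
  have [K2 K20 HK2] := expmx_lipschitz A 1%:M 1%:M tau0.
  have [M M0 HM] := abs_continuous_bounded tau0 acw.
  pose K := n%:R * K1 + n%:R * K2 * M.
  apply: (abs_continuous_le (K := K) _ acw).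
    by rewrite addr_ge0// !mulr_ge0.
  move=> x y x0 xy yt.
  (* The first term is a bounded factor times an increment of [w], the second a Lipschitz increment
     times a bounded [w]. *)
  have -> : F y - F x = expmx ((tau - y) *: A) *m (w y - w x)
                        - (expmx ((tau - x) *: A) - expmx ((tau - y) *: A)) *m w x.
    by rewrite mulmxBr mulmxBl opprB addrA subrK.
  have {}HK1 : `|expmx ((tau - y) *: A)| <= K1.
    by have := HK1 (tau - y); rewrite mul1mx mulmx1; apply; apply/andP; split; lra.
  have {}HK2 : `|expmx ((tau - x) *: A) - expmx ((tau - y) *: A)| <= K2 * (y - x).
    have := HK2 (tau - y) (tau - x); rewrite !mul1mx !mulmx1.
    by rewrite (_ : tau - x - (tau - y) = y - x); [apply; lra | ring].
  have {}HM : `|w x| <= M by apply: HM; rewrite x0; lra.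
  rewrite (le_trans (ler_normB _ _))//.
  apply: (@le_trans _ _ (n%:R * K1 * `|w y - w x| + n%:R * (K2 * (y - x)) * M)).
    rewrite lerD// (le_trans (norm_mulmx _ _))//.
      by rewrite ler_wpM2r// ler_wpM2l.
    by rewrite ler_pM// ?mulr_ge0// ler_wpM2l.
  rewrite -subr_ge0.
  have -> : K * (`|w y - w x| + (y - x)) -
     (n%:R * K1 * `|w y - w x| + n%:R * (K2 * (y - x)) * M) =
     n%:R * K1 * (y - x) + n%:R * K2 * M * `|w y - w x| by rewrite /K; ring.
  by rewrite addr_ge0// !mulr_ge0// subr_ge0.
have aeF := ae_filter_ringOfSetsType (@lebesgue_measure R).
apply: filterS dw => t /[apply] dwt.
(* Zero is written in the shape given by the product rule; the sign comes from the reflected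
   time. *)
rewrite (_ : 0 = - (expmx ((tau - t) *: A) *m A) *m w t
                 + expmx ((tau - t) *: A) *m (A *m w t)); last first.
  by rewrite mulNmx mulmxA addNr.
apply: is_derive_mulmx => //.
apply: (@is_derive_reflect _ _ _ (fun s => expmx (s *: A))).
have := is_derive_expmx A 1%:M 1%:M (tau - t); rewrite !mul1mx mulmx1.
by rewrite (_ : (fun s => _) = (fun s => expmx (s *: A)))//;
  apply/funext => s; rewrite mulmx1 mul1mx.
Qed.

Lemma free_trajectory (R : realType) n p (A : 'M[R]_n) (B : 'M[R]_(n, p)) (tau : R)
    (x0 : 'cV[R]_n) :
  0 <= tau -> trajectory A B tau (fun=> 0) x0 (fun t => expmx (t *: A) *m x0).
Proof.
move=> tau0; split; last by rewrite scale0r expmx0 mul1mx.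
- have [K K0 HK] := expmx_lipschitz A 1%:M x0 tau0.
  apply: (abs_continuous_lipschitz K0) => x y ax xy yb.
  by have := HK x y ax xy yb; rewrite !mul1mx.
- apply: aeW => t _; have := is_derive_expmx A 1%:M x0 t.
  rewrite !mul1mx mulmx0 addr0.
  (* The equation has [A] on the left, whereas [is_derive_expmx] puts it next to [x0]. *)
  have -> : A *m (expmx (t *: A) *m x0) = expmx (t *: A) *m (A *m x0).
    by rewrite mulmxA expmx_comm -mulmxA.
  by rewrite (_ : (fun s => _) = (fun s => expmx (s *: A) *m x0))//;
    apply/funext => s; rewrite mul1mx.
Qed.

(** The difference of two trajectories under one control solves the homogeneous equation.
    Conversely, the zero control provides explicit trajectories as witnesses. *)
Lemma distinguished_atE (R : realType) n p m (A : 'M[R]_n) (B : 'M[R]_(n, p))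
    (C : 'M[R]_(m, n)) (x0 z0 : 'cV[R]_n) (tau : R) :
  0 <= tau ->
  distinguished_at A B C x0 z0 tau <-> C *m expmx (tau *: A) *m (x0 - z0) <> 0.
Proof.
move=> tau0; split.
  move=> [u [x [z [_ [acx dx <-] [acz dz <-] Cxz]]]] E0; apply: Cxz.
  apply/eqP; rewrite -subr_eq0 -mulmxBr; apply/eqP.
  rewrite -E0 -mulmxA; congr (_ *m _).
  apply: (@homogeneous_solution _ _ _ _ (fun t => x t - z t)) => //.
    exact: abs_continuousB.
  have aeF := ae_filter_ringOfSetsType (@lebesgue_measure R).
  apply: filterS2 dx dz => t dx dz tt.
  rewrite (_ : A *m _ = A *m x t + B *m u t - (A *m z t + B *m u t)).
    exact: (is_deriveB (dx tt) (dz tt)).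
  by rewrite mulmxBr opprD addrACA subrr addr0.
move=> E0; exists (fun=> 0), (fun t => expmx (t *: A) *m x0), (fun t => expmx (t *: A) *m z0).
split; [|exact: free_trajectory..|].
- move=> i; rewrite (_ : _ \o _ = cst 0%E); first exact: integrable0.
  by apply/funext => t; rewrite /= mxE.
- by move=> E; apply: E0; rewrite mulmxBr -!mulmxA E subrr.
Qed.

(** * Rank, kernels and Cayley-Hamilton *)

(** Full row space gives a left inverse of [K]. Conversely, each row of the kernel of [K^T]
    transposes to a column killed by [K]. *)
Lemma rank_eq_width (F : fieldType) m n (K : 'M[F]_(m, n)) :
  \rank K = n <-> forall v : 'cV[F]_n, K *m v = 0 -> v = 0.
Proof.
split=> [rK v Kv|H].
  have /row_fullP[L LK] : row_full K by rewrite /row_full rK.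
  by rewrite -[v]mul1mx -LK -mulmxA Kv mulmx0.
apply/eqP; rewrite -mxrank_tr -[_ == _]/(row_free K^T) -kermx_eq0.
apply/eqP/row_matrixP => i; rewrite row0; apply: trmx_inj; rewrite trmx0.
by apply: H; apply: trmx_inj; rewrite trmx_mul trmxK -row_mul mulmx_ker row0 trmx0.
Qed.

Lemma unitmx_ker (F : fieldType) n (M : 'M[F]_n) :
  M \in unitmx <-> forall v : 'cV[F]_n, M *m v = 0 -> v = 0.
Proof.
rewrite -row_full_unit; split=> [/eqP|] H; first exact/rank_eq_width.
exact/eqP/rank_eq_width.
Qed.

(** ['X^k] and its remainder modulo the characteristic polynomial agree at [A] by
    Cayley-Hamilton. *)
Lemma expr_mx_lt (F : fieldType) n (A : 'M[F]_n) k :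
  exists c : 'I_n -> F, A ^+ k = \sum_(i < n) c i *: A ^+ i.
Proof.
case: n A => [|n] A.
  by exists (fun=> 0); apply/matrixP => -[].
pose r := 'X^k %% char_poly A.
(* Past the size of [r] these coefficients are the default value 0, which pads the sum to [n.+1]
   terms. *)
exists (fun i => r`_i).
have sr : (size r <= n.+1)%N.
  by rewrite -ltnS -(size_char_poly A) ltn_modp -size_poly_eq0 size_char_poly.
have Ar : A ^+ k = horner_mx A r.
  rewrite -{1}(horner_mx_X A) -rmorphXn /= (divp_eq 'X^k (char_poly A)).
  by rewrite rmorphD rmorphM /= Cayley_Hamilton mulr0 add0r.
rewrite Ar -{1}(coefK r) poly_def.
rewrite (big_ord_widen n.+1 (fun i => r`_i *: 'X^i) sr) big_mkcond /= linear_sum /=.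
apply: eq_bigr => i _; case: ltnP => ri.
  by rewrite linearZ /= rmorphXn /= horner_mx_X.
by rewrite nth_default// scale0r linear0.
Qed.

Lemma kalman_obs_mxP (R : realType) n m (A : 'M[R]_n) (C : 'M[R]_(m, n)) (v : 'cV[R]_n) :
  kalman_obs_mx A C *m v = 0 <-> forall k, C *m A ^+ k *m v = 0.
Proof.
rewrite /kalman_obs_mx mxcol_mul; split=> [|H]; last first.
  by rewrite -(mxcol0 (p_ := fun=> m)); apply: eq_mxcol => k; exact: H.
rewrite -[0](mxcol0 (p_ := fun=> m)) => /eq_mxcolP H k.
have [c ->] := expr_mx_lt A k.
rewrite mulmx_sumr mulmx_suml big1// => i _.
by rewrite -scalemxAr -scalemxAl H scaler0.
Qed.

(** * Unobservable vectors and the exponential *)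

Lemma expmx_unobservable (R : realType) n m (A : 'M[R]_n) (C : 'M[R]_(m, n)) (v : 'cV[R]_n) :
  (forall k, C *m A ^+ k *m v = 0) -> forall t : R, C *m expmx (t *: A) *m v = 0.
Proof.
move=> H t; apply/matrixP => i j; rewrite expmxE.
rewrite (_ : pseries _ t = cst 0); first by rewrite lim_cst// mxE.
apply/funext => k; rewrite /pseries /series /= big1// => l _.
by rewrite /exp_entry H mxE mulr0 mul0r.
Qed.

Lemma unobservable_of_expmx (R : realType) n m (A : 'M[R]_n) (C : 'M[R]_(m, n))
    (v : 'cV[R]_n) (T : R) :
  0 < T -> (forall t, 0 < t < T -> C *m expmx (t *: A) *m v = 0) ->
  forall k, C *m A ^+ k *m v = 0.
Proof.
move=> T0 H.
(* Each differentiation moves one more factor [A] onto [v]. The derivative at [t] is computed in two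
   ways: by the exponential formula, and as 0 since the function vanishes near [t]. *)
have H' k t : 0 < t < T -> C *m expmx (t *: A) *m (A ^+ k *m v) = 0.
  elim: k t => [t tT|k IH t tT]; first by rewrite expr0 mul1mx H.
  rewrite (exprS A k) -[A * _]/(A *m _) -(mulmxA A).
  have [_ <-] := is_derive_expmx A C (A ^+ k *m v) t.
  suff [_ ->] : is_derive t 1 (fun s => C *m expmx (s *: A) *m (A ^+ k *m v)) 0 by [].
  apply: (near_eq_is_derive (f := cst 0)).
  have tT' : t \in `]0, T[ by rewrite in_itv.
  near=> s; rewrite IH//.
  have : s \in `]0, T[ by near: s; exact: near_in_itvoo.
  by rewrite in_itv.
move=> k.
(* The function vanishes on the right of 0, so its value at 0, which is [C *m A ^+ k *m v], vanishes
   by continuity. *)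
have := @continuous_expmx R m n 1 A C (A ^+ k *m v) 0.
rewrite /continuous_at scale0r expmx0 mulmx1 mulmxA => /cvg_at_right_filter Hr.
apply/esym; apply: cvg_unique Hr; first exact: norm_hausdorff.
apply: cvg_near_cst; near=> t; apply: H'; apply/andP; split; near: t.
  exact: nbhs_right_gt.
exact: nbhs_right_lt.
Unshelve. all: by end_near. Qed.

(** * Integrals of continuous functions and the Gramian *)

Lemma continuous_integrable_itv (R : realType) (T : R) (h : R -> R) :
  continuous h -> lebesgue_measure.-integrable `[0, T] (EFin \o h).
Proof.
move=> hc; apply: continuous_compact_integrable; first exact: segment_compact.
exact: continuous_subspaceT.
Qed.

Lemma continuous_linear_combination (R : realType) (I : Type) (s : seq I) (a : I -> R)
    (h : I -> R -> R) :
  (forall i, continuous (h i)) -> continuous (fun t => \sum_(i <- s) a i * h i t).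
Proof.
move=> hc; elim: s => [|j s IH] t.
  by under [X in continuous_at _ X]funext do rewrite big_nil; exact: cvg_cst.
under [X in continuous_at _ X]funext do rewrite big_cons.
by apply: continuousD (IH t); apply: continuousM; [exact: cst_continuous | exact: hc].
Qed.

Lemma Rintegral_itv_sum (R : realType) (T : R) (I : Type) (s : seq I) (a : I -> R)
    (h : I -> R -> R) :
  (forall i, continuous (h i)) ->
  \int[lebesgue_measure]_(t in `[0, T]) (\sum_(i <- s) a i * h i t) =
  \sum_(i <- s) a i * \int[lebesgue_measure]_(t in `[0, T]) h i t.
Proof.
move=> hc; elim: s => [|i s IH].
  by rewrite big_nil; under eq_Rintegral do rewrite big_nil; rewrite Rintegral_cst// mul0r.
under eq_Rintegral do rewrite big_cons.
rewrite RintegralD//.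
- by rewrite IH big_cons RintegralZl//; exact: continuous_integrable_itv.
- apply: continuous_integrable_itv => t.
  by apply: continuousM; [exact: cst_continuous | exact: hc].
- by apply: continuous_integrable_itv; exact: continuous_linear_combination.
Qed.

(** A nonzero value at [t] persists on a ball inside the interval. The vanishing integral puts this
    ball into a null set, yet its measure is positive. *)
Lemma Rintegral_itv_eq0 (R : realType) (T : R) (h : R -> R) :
  continuous h -> (forall t, 0 <= h t) ->
  \int[lebesgue_measure]_(t in `[0, T]) h t = 0 ->
  forall t, 0 < t < T -> h t = 0.
Proof.
move=> hc h0 hI t tT; apply: contrapT => /eqP ht.
have hint := @continuous_integrable_itv R T h hc.
have mh : measurable_fun (`[0, T]%classic : set R) (EFin \o h) by case/integrableP: hint.
have I0 : (\int[lebesgue_measure]_(t in `[0%R, T]) `|(EFin \o h) t| = 0)%E.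
  transitivity (\int[lebesgue_measure]_(s in `[0%R, T]) (h s)%:E)%E.
    by apply: eq_integral => s _ /=; rewrite ger0_norm.
  (* The real integral is the [fine] of the extended one, and [fine] sends infinities to 0 as well;
     integrability excludes them. *)
  rewrite -[LHS]fineK; first by congr (_%:E); exact: hI.
  exact: integrable_fin_num.
have mT : measurable (`[0, T]%classic : set R) by [].
have [N [mN N0 subN]] := (ae_eq_integral_abs (@lebesgue_measure R) mT mh).1 I0.
have [r /= r0 rh] : exists2 r, 0 < r & ball t r `<=` [set s | h s != 0] `&` `]0, T[.
  suff /nbhs_ballP[r r0 rH] : nbhs t ([set s | h s != 0] `&` `]0, T[) by exists r.
  apply: filterI; first exact: (hc t) (open_nbhs_nbhs (conj (@open_neq R 0) ht)).
  by apply: near_in_itvoo; rewrite in_itv.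
have bN : ball t r `<=` N.
  move=> s /rh [/= hs /=]; rewrite in_itv /= => /andP[s0 sT].
  apply: subN => /= H; move: hs; have : (EFin \o h) s = cst 0%E s.
    by apply: H; rewrite /= in_itv /= !ltW.
  by move=> [->]; rewrite eqxx.
have : lebesgue_measure (ball t r) = 0%E :> \bar R.
  by apply: (subset_measure0 _ mN bN N0); exact: measurable_ball.
rewrite lebesgue_measure_ball ?ltW// => -[/eqP].
by rewrite mulrn_eq0 /= gt_eqF.
Qed.

Lemma gramian_integrand_continuous (R : realType) n m (A : 'M[R]_n) (C : 'M[R]_(m, n)) i j :
  continuous (fun t : R => (expmx (t *: A^T) *m C^T *m C *m expmx (t *: A)) i j).
Proof.
move=> t; apply/differentiable_continuous/derivable1_diffP.
have H := is_derive_mulmx (is_derive_expmx A^T 1%:M C^T t) (is_derive_expmx A C 1%:M t).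
have /is_derive_mx/(_ i j)[+ _] := H.
rewrite (_ : (fun s => _) = (fun t : R => (expmx (t *: A^T) *m C^T *m C *m expmx (t *: A)) i j))//.
by apply/funext => s; rewrite mul1mx mulmx1 !mulmxA.
Qed.

Lemma obs_gramian_ker (R : realType) n m (A : 'M[R]_n) (C : 'M[R]_(m, n)) (v : 'cV[R]_n) (T : R) :
  0 < T ->
  obs_gramian A C T *m v = 0 <-> (forall k, C *m A ^+ k *m v = 0).
Proof.
move=> T0; split=> [Rv|/expmx_unobservable H]; last first.
  apply/matrixP => i j; rewrite !mxE.
  under eq_bigr => k _ do rewrite mxE mulrC.
  rewrite -(@Rintegral_itv_sum _ _ _ _ (fun k => v k j)); last first.
    by move=> k; exact: gramian_integrand_continuous.
  rewrite (@eq_Rintegral _ _ _ _ _ (cst 0)); first by rewrite Rintegral_cst// mul0r.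
  move=> t _ /=.
  transitivity ((expmx (t *: A^T) *m C^T *m (C *m expmx (t *: A) *m v)) i j).
    by rewrite !mulmxA [RHS]mxE; apply: eq_bigr => k _; rewrite mulrC.
  by rewrite H mulmx0 !mxE.
apply: (unobservable_of_expmx T0) => t tT.
pose y s := C *m expmx (s *: A) *m v.
pose h s := \sum_(i < m) y s i 0 ^+ 2.
(* The squared length of [y s] is a combination of the entries of the Gramian integrand, with
   coefficients constant in [s]; integrating term by term yields the quadratic form of the Gramian
   at [v]. *)
have hE s : h s = \sum_(ij : 'I_n * 'I_n) (v ij.1 0 * v ij.2 0) *
    (expmx (s *: A^T) *m C^T *m C *m expmx (s *: A)) ij.1 ij.2.
  transitivity (((y s)^T *m y s) 0 0).
    by rewrite [RHS]mxE; apply: eq_bigr => i _; rewrite [(y s)^T _ _]mxE expr2.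
  rewrite -(pair_bigA _ (fun i j => v i 0 * v j 0 *
    (expmx (s *: A^T) *m C^T *m C *m expmx (s *: A)) i j)) /=.
  rewrite /y !trmx_mul -expmx_tr linearZ /= -!mulmxA mxE.
  apply: eq_bigr => i _; rewrite !mulmxA !mxE.
  rewrite mulr_sumr; apply: eq_bigr => j _; rewrite -!mulmxA; ring.
have hc : continuous h.
  rewrite (funext hE); apply: (@continuous_linear_combination R _ _
    (fun ij => v ij.1 0 * v ij.2 0)
    (fun ij s => (expmx (s *: A^T) *m C^T *m C *m expmx (s *: A)) ij.1 ij.2)) => ij.
  exact: gramian_integrand_continuous.
have h_eq0 : h t = 0.
  apply: (@Rintegral_itv_eq0 _ T) => // [s|].
    by apply: sumr_ge0 => i _; exact: sqr_ge0.
  under eq_Rintegral do rewrite hE.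
  rewrite (@Rintegral_itv_sum _ _ _ _ (fun ij => v ij.1 0 * v ij.2 0)
   (fun ij s => (expmx (s *: A^T) *m C^T *m C *m expmx (s *: A)) ij.1 ij.2)); last first.
    by move=> ij; exact: gramian_integrand_continuous.
  transitivity ((v^T *m (obs_gramian A C T *m v)) 0 0); last by rewrite Rv mulmx0 mxE.
  rewrite -(pair_bigA _ (fun i j => v i 0 * v j 0 * \int[lebesgue_measure]_(s in `[0, T])
    (expmx (s *: A^T) *m C^T *m C *m expmx (s *: A)) i j)) /=.
  rewrite mxE; apply: eq_bigr => i _; rewrite !mxE mulr_sumr.
  by apply: eq_bigr => j _; rewrite mxE; ring.
(* A vanishing sum of squares has vanishing terms. *)
apply/matrixP => i j; rewrite (ord1 j) [RHS]mxE.
apply/eqP; rewrite -sqrf_eq0; apply/eqP; move: i {j} isT.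
apply/psumr_eq0P => //.
by move=> i _; exact: sqr_ge0.
Qed.

(** * The equivalence of the five conditions *)

Unset Implicit Arguments.

Theorem theorem4p1 (R : realType) (n p m : nat)
    (n_ge1 : (1 <= n)%N) (p_ge1 : (1 <= p)%N) (m_ge1 : (1 <= m)%N)
    (A : 'M[R]_n) (B : 'M[R]_(n, p)) (C : 'M[R]_(m, n))
    (T : R) (T_gt0 : 0 < T) :
  [<-> observable A B C;
       observable_at_time A B C T;
       exists2 S : R, 0 < S & obs_gramian A C S \in unitmx;
       forall S : R, 0 < S -> obs_gramian A C S \in unitmx;
       \rank (kalman_obs_mx A C) = n].
Proof.
pose unobs (v : 'cV[R]_n) := forall k, C *m A ^+ k *m v = 0.
have gramE S : 0 < S -> obs_gramian A C S \in unitmx <-> (forall v, unobs v -> v = 0).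
  move=> S0; rewrite unitmx_ker; split=> H v; first by move/(obs_gramian_ker _ _ _ S0)/H.
  by move=> /(obs_gramian_ker _ _ _ S0)/H.
have dist0 tau x0 z0 : 0 < tau -> unobs (x0 - z0) -> ~ distinguished_at A B C x0 z0 tau.
  move=> tau0 /expmx_unobservable H /distinguished_atE -/(_ (ltW tau0)); exact.
(* By contraposition: if no time up to [S] distinguishes [x0] from [z0], their difference is
   unobservable, hence zero. *)
have obs_time : (forall v, unobs v -> v = 0) -> forall S, 0 < S -> observable_at_time A B C S.
  move=> H S S0 x0 z0 xz; apply: contrapT => ndist; apply: xz.
  apply/eqP; rewrite -subr_eq0; apply/eqP/H.
  apply: (unobservable_of_expmx S0) => t /andP[t0 tS].
  apply: contrapT => Ct; apply: ndist; exists t; first by rewrite t0 ltW.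
  by apply/distinguished_atE => //; exact: ltW.
tfae.
- move=> obs; apply: obs_time => // v uv; apply: contrapT => v0.
  (* Comparing [v] with the state 0 makes the difference equal to [v]. *)
  have [tau tau0] := obs v 0 v0; apply: dist0 => //; by rewrite subr0.
- move=> obs; exists T => //; apply/gramE => // v uv; apply: contrapT => v0.
  have [tau /andP[tau0 _]] := obs v 0 v0; apply: dist0 => //; by rewrite subr0.
- by move=> [S0 S0gt0 /(gramE _ S0gt0) H] S Sgt0; exact/gramE.
- move=> H; apply/rank_eq_width => v /kalman_obs_mxP.
  (* The time 1 is an arbitrary positive choice. *)
  by apply/(gramE 1 ltr01).1/H/ltr01.
- move=> /rank_eq_width H x0 z0 xz.
  have [|tau /andP[tau0 _] dist] := obs_time _ 1 ltr01 x0 z0 xz; last by exists tau.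
  by move=> v /kalman_obs_mxP /H.
Qed.
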